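(* Let $m>n$ be positive integers, let $A$ be a real $m\times n$ matrix of full rank $n$, and let $F$ be a real matrix with $m$ columns such that $FA=0$. Let $S\ge1$ be an integer such that the constants of $F$ satisfy $$\delta_S+\theta_{S,S}+\theta_{S,2S}<1 .$$ Let $f\in\mathbf{R}^n$ and set $y=Af+e$, where $e\in\mathbf{R}^m$ is a real vector supported on a set of size at most $S$. Then $f$ is the unique minimizer of $$\min_{g\in\mathbf{R}^n}\ \|y-Ag\|_{\ell_1}.$$
   Context: Notation: $\|\cdot\|$ is the Euclidean norm, $\langle\cdot,\cdot\rangle$ the Euclidean inner product, and $\|x\|_{\ell_1}=\sum_i|x_i|$. Let $J=\{1,\dots,m\}$ index the columns $v_j$ of $F$. For $T\subseteq J$, $F_T$ is the submatrix of $F$ with columns $v_j$, $j\in T$, so $F_Tc=\sum_{j\in T}c_jv_j$. Restricted isometry constants: for an integer $1\le S\le|J|$, $\delta_S$ is the smallest quantity such that $(1-\delta_S)\|c\|^2\le\|F_Tc\|^2\le(1+\delta_S)\|c\|^2$ for all $T\subset J$ with $|T|\le S$ and all real $(c_j)_{j\in T}$. Restricted orthogonality constants: for integers $S,S'\ge1$ with $S+S'\le|J|$, $\theta_{S,S'}$ is the smallest quantity such that $|\langle F_Tc,F_{T'}c'\rangle|\le\theta_{S,S'}\|c\|\,\|c'\|$ for all disjoint $T,T'\subseteq J$ with $|T|\le S$, $|T'|\le S'$ and all real coefficient vectors $c\in\mathbf{R}^T$, $c'\in\mathbf{R}^{T'}$. The use of $\theta_{S,2S}$ presupposes $3S\le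 m$. *)

(* Defs.v *)
From mathcomp Require Import all_boot all_order all_algebra.
From mathcomp Require Import classical_sets reals.

Set Implicit Arguments.
Unset Strict Implicit.
Unset Printing Implicit Defensive.

Import Order.TTheory GRing.Theory Num.Theory.

Local Open Scope ring_scope.

Section VectorNorms.
Context {R : realType}.

Definition inner n (u v : 'cV[R]_n) : R := \sum_(i < n) u i 0 * v i 0.

(* The norm `|x| that MathComp-Analysis puts on matrices is the sup norm. *)
Definition norm2 n (u : 'cV[R]_n) : R := Num.sqrt (inner u u).

Definition norm1 n (u : 'cV[R]_n) : R := \sum_(i < n) `|u i 0|.

End VectorNorms.

(* R^T is represented by column vectors of length #|T|, through the
   enumeration of T. *)
Definition subcols {R : realType} p m (F : 'M[R]_(p, m)) (T : {set 'I_m}) :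
    'M[R]_(p, #|T|) :=
  colsub (fun j : 'I_#|T| => enum_val j) F.

Definition supported_on {R : realType} m (e : 'cV[R]_m) (T : {set 'I_m}) :
    Prop :=
  forall i, i \notin T -> e i 0 = 0.

Section RestrictedConstants.
Context {R : realType} {p m : nat}.
Implicit Types (F : 'M[R]_(p, m)) (S : nat) (d t : R).

Definition isometry_bound F S d : Prop :=
  forall (T : {set 'I_m}) (c : 'cV[R]_#|T|), (#|T| <= S)%N ->
    (1 - d) * norm2 c ^+ 2 <= norm2 (subcols F T *m c) ^+ 2
    /\ norm2 (subcols F T *m c) ^+ 2 <= (1 + d) * norm2 c ^+ 2.

(* The infimum is attained: see ric_smallest below. *)
Definition ric F S : R := inf [set d | isometry_bound F S d]%classic.

Definition orthogonality_bound F S S' t : Prop :=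
  forall (T T' : {set 'I_m}) (c : 'cV[R]_#|T|) (c' : 'cV[R]_#|T'|),
    [disjoint T & T'] -> (#|T| <= S)%N -> (#|T'| <= S')%N ->
    `|inner (subcols F T *m c) (subcols F T' *m c')|
      <= t * (norm2 c * norm2 c').

(* The infimum is attained: see roc_smallest below. *)
Definition roc F S S' : R := inf [set t | orthogonality_bound F S S' t]%classic.

End RestrictedConstants.

Definition minimizer {R : realType} {X : Type} (phi : X -> R) (x : X) : Prop :=
  forall y, phi x <= phi y.

Section Smallest.
Context {R : realType} {p m : nat}.
Implicit Types (F : 'M[R]_(p, m)) (S : nat) (d t : R).

Lemma inner_ge0 n (u : 'cV[R]_n) : 0 <= inner u u.
Proof. by apply: sumr_ge0 => i _; rewrite -expr2 sqr_ge0. Qed.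

Lemma norm2_ge0 n (u : 'cV[R]_n) : 0 <= norm2 u.
Proof. exact: sqrtr_ge0. Qed.

Lemma sqr_norm2 n (u : 'cV[R]_n) : norm2 u ^+ 2 = inner u u.
Proof. by rewrite sqr_sqrtr // inner_ge0. Qed.

Lemma coord_le_norm2 n (u : 'cV[R]_n) i : `|u i 0| <= norm2 u.
Proof.
rewrite -sqrtr_sqr; apply: ler_wsqrtr; rewrite /inner (bigD1 i) //= -expr2.
by rewrite lerDl; apply: sumr_ge0 => j _; rewrite -expr2 sqr_ge0.
Qed.

Definition gram_mass F : R :=
  \sum_(k < p) \sum_(j < m) \sum_(j' < m) `|F k j * F k j'|.

Lemma gram_mass_ge0 F : 0 <= gram_mass F.
Proof. by do 3!(apply: sumr_ge0 => ? _). Qed.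

Lemma ler_sum_enum_val (T : {set 'I_m}) (g : 'I_m -> R) :
  (forall j, 0 <= g j) -> \sum_(i < #|T|) g (enum_val i) <= \sum_(j < m) g j.
Proof.
move=> g0; rewrite -(big_enum_val g) [leRHS](bigID (mem T)) /=.
by rewrite lerDl; apply: sumr_ge0.
Qed.

Lemma inner_subcols_le F (T T' : {set 'I_m}) (c : 'cV[R]_#|T|)
    (c' : 'cV[R]_#|T'|) :
  `|inner (subcols F T *m c) (subcols F T' *m c')|
    <= gram_mass F * (norm2 c * norm2 c').
Proof.
apply: le_trans (ler_norm_sum _ _ _) _.
rewrite /gram_mass mulr_suml; apply: ler_sum => k _.
rewrite !mxE mulr_suml; apply: le_trans (ler_norm_sum _ _ _) _.
rewrite mulr_suml.
pose h j := (\sum_(j' < m) `|F k j * F k j'|) * (norm2 c * norm2 c').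
apply: le_trans (ler_sum_enum_val T (g := h) _); last first.
  by move=> j; rewrite /h !mulr_ge0 ?norm2_ge0 // sumr_ge0.
apply: ler_sum => i _; rewrite mulr_sumr.
apply: le_trans (ler_norm_sum _ _ _) _; rewrite /h mulr_suml.
pose h' j' := `|F k (enum_val i) * F k j'| * (norm2 c * norm2 c').
apply: le_trans (ler_sum_enum_val T' (g := h') _); last first.
  by move=> j; rewrite /h' !mulr_ge0 ?norm2_ge0.
apply: ler_sum => i' _; rewrite /h' !mxE mulrACA normrM.
by rewrite ler_wpM2l // normrM ler_pM // coord_le_norm2.
Qed.

Lemma inf_attained (E : set R) (a b : R) : (E !=set0)%classic -> 0 <= b ->
  (forall d, E d -> a <= d * b) -> a <= inf E * b.
Proof.
move=> E0; rewrite le_eqVlt => /predU1P[<-|b0] aE.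
  by have [d /aE] := E0; rewrite !mulr0.
rewrite -ler_pdivrMr //; apply: lb_le_inf => // d Ed.
by rewrite ler_pdivrMr // aE.
Qed.

Lemma isometry_bound_neq0 F S : ([set d | isometry_bound F S d] !=set0)%classic.
Proof.
exists (1 + gram_mass F) => T c _; rewrite !sqr_norm2; split.
  rewrite opprD addNKr mulNr; apply: le_trans (inner_ge0 _).
  by rewrite oppr_le0 mulr_ge0 ?gram_mass_ge0 ?inner_ge0.
apply: le_trans (ler_norm _) _; apply: le_trans (inner_subcols_le _ _ _) _.
rewrite -expr2 sqr_norm2 ler_wpM2r ?inner_ge0 // addrA lerDr.
by rewrite addr_ge0.
Qed.

Lemma isometry_bound_ge0 F S d : (1 <= S <= m)%N ->
  isometry_bound F S d -> 0 <= d.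
Proof.
case/andP=> S1 Sm Fd; have m0 : (0 < m)%N by apply: leq_trans Sm.
pose T : {set 'I_m} := [set Ordinal m0].
have T1 : #|T| = 1%N by rewrite cards1.
have [|le1 le2] := Fd T (const_mx 1); first by rewrite T1.
have := le_trans le1 le2; rewrite ler_pM2r; last first.
  rewrite sqr_norm2 /inner; under eq_bigr do rewrite !mxE mulr1.
  by rewrite sumr_const card_ord T1.
by rewrite lerD2l -subr_ge0 opprK -mulr2n pmulrn_lge0.
Qed.

Lemma ric_smallest F S : (1 <= S <= m)%N ->
  isometry_bound F S (ric F S)
  /\ forall d, isometry_bound F S d -> ric F S <= d.
Proof.
move=> hS; split=> [T c TS|d Fd]; last first.
  by apply: ge_inf => //; exists 0 => d'; apply: isometry_bound_ge0.
have N0 := exprn_ge0 2 (norm2_ge0 c); split.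
  rewrite mulrBl mul1r lerBlDl -lerBlDr.
  apply: inf_attained => // [|d /(_ T c TS)[+ _]].
    exact: isometry_bound_neq0.
  by rewrite mulrBl mul1r lerBlDl -lerBlDr.
rewrite mulrDl mul1r -lerBlDl.
apply: inf_attained => // [|d /(_ T c TS)[_]].
  exact: isometry_bound_neq0.
by rewrite mulrDl mul1r -lerBlDl.
Qed.

Lemma orthogonality_bound_ge0 F S S' t :
  (1 <= S)%N -> (1 <= S')%N -> (S + S' <= m)%N ->
  orthogonality_bound F S S' t -> 0 <= t.
Proof.
move=> S1 S1' Sm Ft.
have m1 : (1 < m)%N by apply: leq_trans Sm; rewrite (leq_add S1 S1').
pose T : {set 'I_m} := [set Ordinal (ltnW m1)].
pose T' : {set 'I_m} := [set Ordinal m1].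
have T1 : #|T| = 1%N by rewrite cards1.
have T1' : #|T'| = 1%N by rewrite cards1.
have dT : [disjoint T & T'] by rewrite disjoints1 inE.
have TS : (#|T| <= S)%N by rewrite T1.
have TS' : (#|T'| <= S')%N by rewrite T1'.
have := Ft T T' (const_mx 1) (const_mx 1) dT TS TS'.
move=> /(le_trans (normr_ge0 _)).
have norm1E n : n = 1%N -> norm2 (const_mx 1 : 'cV[R]_n) = 1.
  move=> ->; rewrite /norm2 /inner big_ord1 !mxE mulr1.
  exact: sqrtr1.
by rewrite !norm1E // !mulr1.
Qed.

Lemma roc_smallest F S S' :
  (1 <= S)%N -> (1 <= S')%N -> (S + S' <= m)%N ->
  orthogonality_bound F S S' (roc F S S')
  /\ forall t, orthogonality_bound F S S' t -> roc F S S' <= t.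
Proof.
move=> S1 S1' Sm; split=> [T T' c c' dT TS TS'|t Ft]; last first.
  apply: ge_inf => //; exists 0 => t'.
  exact: orthogonality_bound_ge0.
apply: inf_attained => [||t Ft]; last exact: Ft.
  by exists (gram_mass F) => A A' a a' _ _ _; apply: inner_subcols_le.
by rewrite mulr_ge0 ?norm2_ge0.
Qed.

End Smallest.

(* Main.v *)
Require Import Defs.
From mathcomp Require Import all_boot all_order all_algebra.
From mathcomp Require Import reals zify ring lra.

(** Write g for a competitor of f and h = A (g - f), so that F h = 0 and
    y - A g = e - h.  Since A is injective, everything follows from the null
    space property: a nonzero h in the kernel of F satisfies
    [sum_(T) |h| < sum_(~: T) |h|] for every T with at most S elements
    ([null_space_property]); moving from e to e - h then costs less on T than
    it gains off T ([l1_decrease_le_increase]).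

    For the null space property, suppose the inequality fails for some T.  It
    then also fails for the set T0 of the S largest entries of h in absolute
    value ([sum_le_top]), that is, the l1 norm of h is at most twice that of
    h_T0.  Cut the complement of T0 into blocks T1, T2, ... of size S of
    decreasing magnitude.  Every entry of a block is at most the mean of the
    entries of the previous block, so that
    [sum_(j >= 1) ||h_Tj|| <= S^(-1/2) ||h||_1 <= 2 S^(-1/2) ||h_T0||_1
     <= 2 ||h_T0||],
    the last step being Cauchy-Schwarz.  As F h = 0,
    [(1 - delta_S) ||h_T0||^2 <= ||F h_T0||^2
     = - sum_(j >= 1) <F h_T0, F h_Tj>
     <= theta_{S,S} ||h_T0|| * 2 ||h_T0||].
    But theta_{S,S} <= theta_{S,2S}, so the hypothesis says in particular that
    delta_S + 2 theta_{S,S} < 1; hence h_T0 = 0, and h = 0 because the l1 norm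
    of h is controlled by that of h_T0.

    The blocks are peeled off one at a time, by induction on the size of the
    set that remains to be cut ([block_sum_bound]). *)

Set Implicit Arguments.
Unset Strict Implicit.
Unset Printing Implicit Defensive.

Import Order.TTheory GRing.Theory Num.Theory.

Local Open Scope ring_scope.

(** * Largest entries and block decompositions *)

Section Blocks.
Context {R : realType} {I : finType}.
Implicit Types (U V W T : {set I}) (x b : I -> R) (S : nat) (K M : R).

(** Selecting the S largest values of |x| on U.  The threshold M separating
    them from the rest is what the later estimates use; it is kept
    nonnegative so that it can also be compared with missing entries. *)
Lemma top_set x U S : (S <= #|U|)%N ->
  exists V M, [/\ V \subset U, #|V| = S, 0 <= M,
    {in V, forall i, M <= `|x i|} & {in U :\: V, forall i, `|x i| <= M}].
Proof.
elim: S => [_|S IH SU].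
  exists set0, (\sum_i `|x i|); split; rewrite ?sub0set ?cards0 ?sumr_ge0 //.
    by move=> i; rewrite inE.
  by move=> i _; rewrite (bigD1 i) //= lerDl sumr_ge0.
have [V [M [VU cV M0 lowV upV]]] := IH (ltnW SU).
have /set0Pn[i0 i0UV] : U :\: V != set0.
  by rewrite -card_gt0 cardsD (setIidPr VU) cV subn_gt0.
have [j jUV jmax] := arg_maxP (fun i => `|x i|) i0UV.
have /setDP[jU jV] := jUV.
exists (j |: V), `|x j|; split => //.
- by rewrite subUset sub1set jU.
- by rewrite cardsU1 jV cV.
- move=> i /setU1P[->//|iV].
  exact: le_trans (upV _ jUV) (lowV _ iV).
- move=> i; rewrite !inE negb_or => /andP[/andP[_ iV] iU].
  by apply: jmax; apply/setDP.
Qed.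

Lemma threshold_le_sum x V M : {in V, forall i, M <= `|x i|} ->
  #|V|%:R * M <= \sum_(i in V) `|x i|.
Proof. by move=> low; rewrite mulr_natl -sumr_const; apply: ler_sum. Qed.

Lemma sum_le_threshold x V M : {in V, forall i, `|x i| <= M} ->
  \sum_(i in V) `|x i| <= #|V|%:R * M.
Proof. by move=> up; rewrite mulr_natl -sumr_const; apply: ler_sum. Qed.

(** Exchanging the entries of T outside V for those of V outside T does not
    decrease the sum: there are at least as many of the latter, and M separates
    the two. *)
Lemma sum_le_top x V T M : 0 <= M -> (#|T| <= #|V|)%N ->
  {in V, forall i, M <= `|x i|} -> {in ~: V, forall i, `|x i| <= M} ->
  \sum_(i in T) `|x i| <= \sum_(i in V) `|x i|.
Proof.
move=> M0 TV low up.
rewrite (big_setID V) [leRHS](big_setID T) /= setIC lerD2l.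
have cTV : (#|T :\: V| <= #|V :\: T|)%N.
  by rewrite !cardsD [T :&: V]setIC leq_sub2r.
apply: (@le_trans _ _ (#|T :\: V|%:R * M)).
  by apply: sum_le_threshold => i /setDP[_ iV]; apply: up; rewrite inE.
apply: (@le_trans _ _ (#|V :\: T|%:R * M)).
  by rewrite ler_wpM2r ?ler_nat.
by apply: threshold_le_sum => i /setDP[iV _]; apply: low.
Qed.

Lemma sqrt_nat_sqr S : Num.sqrt (S%:R : R) ^+ 2 = S%:R.
Proof. by rewrite sqr_sqrtr. Qed.

Lemma l2_le_threshold x V S M : 0 <= M -> (#|V| <= S)%N ->
  {in V, forall i, `|x i| <= M} ->
  Num.sqrt (\sum_(i in V) x i ^+ 2) <= Num.sqrt S%:R * M.
Proof.
move=> M0 VS up; rewrite -[X in _ * X]ger0_norm // -sqrtr_sqr.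
rewrite -sqrtrM ?ler0n //.
apply/ler_wsqrtr/(@le_trans _ _ (#|V|%:R * M ^+ 2)); last first.
  by rewrite ler_wpM2r ?sqr_ge0 ?ler_nat.
rewrite mulr_natl -sumr_const; apply: ler_sum => i /up xM.
by rewrite -[x i ^+ 2]real_normK ?num_real //; apply: lerXn2r; rewrite ?nnegrE.
Qed.

(** Cauchy-Schwarz against the constant vector, read off from the
    nonnegativity of the variance of |x|. *)
Lemma l1_le_l2 x V :
  \sum_(i in V) `|x i|
    <= Num.sqrt #|V|%:R * Num.sqrt (\sum_(i in V) x i ^+ 2).
Proof.
set a := \sum_(i in V) _; set q := \sum_(i in V) _ ^+ 2.
have a0 : 0 <= a by apply: sumr_ge0.
have q0 : 0 <= q by apply: sumr_ge0 => i _; apply: sqr_ge0.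
have [V0|Vn0] := posnP #|V|.
  by rewrite /a (cards0_eq V0) big_set0 mulr_ge0 ?sqrtr_ge0.
rewrite -sqrtrM ?ler0n // -[a]ger0_norm // -sqrtr_sqr; apply: ler_wsqrtr.
set k : R := #|V|%:R; have k0 : 0 < k by rewrite ltr0n.
have : 0 <= \sum_(i in V) (k * `|x i| - a) ^+ 2.
  by apply: sumr_ge0 => i _; apply: sqr_ge0.
have -> : \sum_(i in V) (k * `|x i| - a) ^+ 2 = k * (k * q - a ^+ 2).
  rewrite (eq_bigr (fun i =>
    k ^+ 2 * x i ^+ 2 - (k * a *+ 2) * `|x i| + a ^+ 2)); last first.
    by move=> i _; rewrite -[x i ^+ 2]real_normK ?num_real //; ring.
  rewrite big_split sumrB -!mulr_sumr sumr_const -mulr_natl -/a -/q -/k /=.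
  ring.
by rewrite pmulr_rge0 // subr_ge0.
Qed.

(** The block decomposition estimate.  The terms b are controlled in l2 on
    sets of size at most S.  If U has at most S elements, the l2 norm of x on
    U is at most sqrt S * M; otherwise the block V of its S largest entries
    contributes at most that much, and the rest has a threshold M' with S * M'
    bounded by the l1 norm of x on V.  That norm pays for the next block, and
    the payments add up to at most the l1 norm of x on U. *)
Lemma block_sum_bound x b S K U M : 0 <= K -> 0 <= M -> (1 <= S)%N ->
  (forall V, V \subset U -> (#|V| <= S)%N ->
    `|\sum_(i in V) b i| <= K * Num.sqrt (\sum_(i in V) x i ^+ 2)) ->
  {in U, forall i, `|x i| <= M} ->
  Num.sqrt S%:R * `|\sum_(i in U) b i|
    <= K * (S%:R * M + \sum_(i in U) `|x i|).
Proof.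
move=> K0 + S1; have [k] := ubnP #|U|.
elim: k U M => // k IH U M Uk M0 bV up.
have s0 : 0 <= Num.sqrt S%:R :> R by apply: sqrtr_ge0.
have small V : V \subset U -> (#|V| <= S)%N ->
    Num.sqrt S%:R * `|\sum_(i in V) b i| <= K * (S%:R * M).
  move=> VU VS.
  apply: le_trans (ler_wpM2l s0 (bV _ VU VS)) _.
  rewrite mulrCA ler_wpM2l // -{2}(sqrt_nat_sqr S) expr2 -mulrA ler_wpM2l //.
  by apply: l2_le_threshold => // i iV; apply/up/(subsetP VU).
have [US|/ltnW SU] := leqP #|U| S.
  by apply: le_trans (small U _ US) _; rewrite // ler_wpM2l // lerDl sumr_ge0.
have [V [M' [VU cV M'0 lowV upV]]] := top_set x SU.
have UVU : U :\: V \subset U by apply: subsetDl.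
have UVk : (#|U :\: V| < k)%N.
  rewrite cardsD (setIidPr VU) cV -ltnS; apply: leq_trans Uk.
  by rewrite ltnS ltn_subrL S1 (leq_trans S1 SU).
have bUV W : W \subset U :\: V -> (#|W| <= S)%N ->
    `|\sum_(i in W) b i| <= K * Num.sqrt (\sum_(i in W) x i ^+ 2).
  by move=> WUV; apply/bV/(subset_trans WUV UVU).
have rest := IH (U :\: V) M' UVk M'0 bUV upV.
have blockV := small V VU (eq_leq cV).
have lowS : S%:R * M' <= \sum_(i in V) `|x i|.
  by rewrite -cV; apply: threshold_le_sum.
rewrite (big_setID V) [X in _ <= _ * (_ + X)](big_setID V) /= (setIidPr VU).
apply: le_trans (ler_wpM2l s0 (ler_normD _ _)) _; rewrite mulrDr.
apply: le_trans (lerD blockV rest) _; rewrite -mulrDr ler_wpM2l //.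
by rewrite lerD2l lerD2r.
Qed.

End Blocks.

(** * Restricted constants in terms of full-length vectors *)

Section Restriction.
Context {R : realType} {p m : nat}.
Implicit Types (F : 'M[R]_(p, m)) (h u : 'cV[R]_m) (T V : {set 'I_m}).

Definition restrict h T : 'cV[R]_m := \col_i (if i \in T then h i 0 else 0).

Definition coords h T : 'cV[R]_#|T| := \col_i h (enum_val i) 0.

Lemma subcols_coords F h T : subcols F T *m coords h T = F *m restrict h T.
Proof.
apply/colP => k; rewrite !mxE.
under eq_bigr do rewrite !mxE.
rewrite -(big_enum_val (fun j => F k j * h j 0)) big_mkcond /=.
by apply: eq_bigr => j _; rewrite mxE; case: ifP => // _; rewrite mulr0.
Qed.

Lemma norm2_coords h T :
  norm2 (coords h T) = Num.sqrt (\sum_(i in T) h i 0 ^+ 2).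
Proof.
rewrite /norm2 /inner; under eq_bigr do rewrite !mxE -expr2.
by rewrite -(big_enum_val (fun j => h j 0 ^+ 2)).
Qed.

Lemma restrict_setC h T : h = restrict h T + restrict h (~: T).
Proof.
by apply/colP => i; rewrite !mxE inE; case: ifP; rewrite ?addr0 ?add0r.
Qed.

Lemma innerDr k (u v w : 'cV[R]_k) : inner u (v + w) = inner u v + inner u w.
Proof.
by rewrite /inner -big_split; apply: eq_bigr => i _; rewrite mxE mulrDr.
Qed.

Lemma inner0r k (u : 'cV[R]_k) : inner u 0 = 0.
Proof. by rewrite /inner big1 // => i _; rewrite mxE mulr0. Qed.

(** The inner product with F h_V is a sum over V of terms that do not depend
    on V, the form in which [block_sum_bound] consumes it. *)
Lemma inner_restrict F (w : 'cV[R]_p) h V :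
  inner w (F *m restrict h V) = \sum_(j in V) h j 0 * inner w (col j F).
Proof.
rewrite /inner; under eq_bigr do rewrite mxE mulr_sumr.
rewrite exchange_big [RHS]big_mkcond /=; apply: eq_bigr => j _.
case: ifP => jV; last by apply: big1 => k _; rewrite mxE jV !mulr0.
rewrite mulr_sumr; apply: eq_bigr => k _; rewrite !mxE jV; ring.
Qed.

(** More competitors are allowed on the right.  This is what turns the stated
    hypothesis into delta_S + 2 theta_{S,S} < 1. *)
Lemma roc_le_double F S : (1 <= S)%N -> (3 * S <= m)%N ->
  roc F S S <= roc F S (2 * S)%N.
Proof.
move=> S1 Sm.
have [|_ least] := roc_smallest F S1 S1; first by lia.
have [||bound _] := roc_smallest F S1 (_ : 1 <= 2 * S)%N; [by lia..|].
by apply: least => T T' c c' dT TS TS'; apply: bound => //; lia.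
Qed.

End Restriction.

(** * The null space property and l1 recovery *)

Section Recovery.
Context {R : realType} {p m : nat}.
Implicit Types (F : 'M[R]_(p, m)) (h e : 'cV[R]_m) (T W : {set 'I_m}).

(** In the notation of the proof, V is the set of the S largest entries of h,
    N and a are the l2 and l1 norms of h on V, and s = sqrt S.  The inner
    products of F h_V with the columns of F, weighted by h, play the role of b in
    [block_sum_bound]; orthogonality to sets disjoint from V gives
    the constant K = theta_{S,S} N. *)
Lemma null_space_property F S h T : (1 <= S)%N -> (3 * S <= m)%N ->
  ric F S + roc F S S + roc F S (2 * S)%N < 1 ->
  F *m h = 0 -> (#|T| <= S)%N ->
  \sum_(i in ~: T) `|h i 0| <= \sum_(i in T) `|h i 0| -> h = 0.
Proof.
move=> S1 Sm small Fh0 TS hT.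
have [|isoS _] := @ric_smallest _ _ _ F S; first by lia.
have [|orthS _] := roc_smallest F S1 S1; first by lia.
have t0 : 0 <= roc F S S by apply: (orthogonality_bound_ge0 S1 S1 _ orthS); lia.
have tt := roc_le_double F S1 Sm.
set d := ric F S in small isoS; set t := roc F S S in small orthS t0 tt.
have dt1 : 2 * t < 1 - d by lra.
have [|V [M [_ cV M0 lowV upV]]] := @top_set _ _ (fun i => h i 0) setT S.
  by rewrite cardsT card_ord; lia.
rewrite setTD in upV.
set N := Num.sqrt (\sum_(i in V) h i 0 ^+ 2).
have N0 : 0 <= N by apply: sqrtr_ge0.
pose s : R := Num.sqrt S%:R.
have s0 : 0 < s by rewrite sqrtr_gt0 ltr0n.
set a := \sum_(i in V) `|h i 0|.
have asN : a <= s * N.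
  by rewrite /s -cV; apply: (l1_le_l2 (fun i => h i 0)).
have splitl1 W : \sum_i `|h i 0| =
    \sum_(i in W) `|h i 0| + \sum_(i in ~: W) `|h i 0|.
  rewrite (bigID (mem W)) /=; congr (_ + _); apply: eq_bigl => i.
  by rewrite inE.
have l1a : \sum_i `|h i 0| <= 2 * a.
  have : \sum_(i in T) `|h i 0| <= a.
    by apply: (sum_le_top M0 _ lowV upV); rewrite cV.
  by rewrite (splitl1 T); lra.
pose w := F *m restrict h V.
pose b j := h j 0 * inner w (col j F).
have bC W : W \subset ~: V -> (#|W| <= S)%N ->
    `|\sum_(i in W) b i| <= t * N * Num.sqrt (\sum_(i in W) h i 0 ^+ 2).
  move=> WV WS; rewrite -inner_restrict /w -!subcols_coords -mulrA.
  rewrite /N -!norm2_coords; apply: orthS; rewrite ?cV //.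
  by rewrite disjoint_sym disjoints_subset.
(* The S entries on V dominate S * M, so the bound is theta N ||h||_1. *)
have tail : s * `|\sum_(i in ~: V) b i| <= t * N * (2 * a).
  apply: le_trans (block_sum_bound (mulr_ge0 t0 N0) M0 S1 bC upV) _.
  rewrite ler_wpM2l ?mulr_ge0 //; apply: le_trans l1a.
  by rewrite (splitl1 V) lerD2r -cV; apply: threshold_le_sum.
have head : (1 - d) * N ^+ 2 <= `|\sum_(i in ~: V) b i|.
  have [+ _] := isoS V (coords h V) (eq_leq cV).
  rewrite norm2_coords -/N sqr_norm2 subcols_coords -/w => /le_trans; apply.
  have : inner w w + inner w (F *m restrict h (~: V)) = 0.
    by rewrite -innerDr -mulmxDr -restrict_setC Fh0 inner0r.
  rewrite inner_restrict => /eqP; rewrite addr_eq0 => /eqP ->.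
  by rewrite -normrN ler_norm.
have Nz : N = 0.
  apply/eqP; rewrite eq_le N0 andbT leNgt; apply/negP => Np.
  have : s * ((1 - d) * N ^+ 2) <= t * N * (2 * (s * N)).
    apply: le_trans (ler_wpM2l (ltW s0) head) _; apply: le_trans tail _.
    by rewrite !ler_wpM2l ?mulr_ge0.
  have -> : t * N * (2 * (s * N)) = s * (2 * t * N ^+ 2) by ring.
  by rewrite ler_pM2l // ler_pM2r ?exprn_gt0 // leNgt dt1.
have l10 : \sum_i `|h i 0| <= 0.
  by apply: le_trans l1a _; rewrite Nz mulr0 in asN; lra.
apply/colP => i; rewrite mxE; apply/normr0_eq0/eqP.
rewrite eq_le normr_ge0 andbT; apply: le_trans l10.
by rewrite (bigD1 i) //= lerDl sumr_ge0.
Qed.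

(** Off T, where e vanishes, the entries of e - h are those of h up to sign;
    on T the triangle inequality bounds the loss by |h|. *)
Lemma l1_decrease_le_increase e h T : supported_on e T ->
  norm1 e + \sum_(i in ~: T) `|h i 0|
    <= norm1 (e - h) + \sum_(i in T) `|h i 0|.
Proof.
move=> eT; rewrite /norm1 [X in _ + X]big_mkcond [X in _ <= _ + X]big_mkcond.
rewrite -!big_split; apply: ler_sum => i _ /=; rewrite !inE !mxE.
case: (boolP (i \in T)) => iT /=; rewrite addr0.
  by rewrite -lerBlDr lerB_dist.
by rewrite (eT i iT) normr0 add0r sub0r normrN.
Qed.

End Recovery.

Theorem theorem1p5 (R : realType) (m n p : nat)
    (n_gt0 : (0 < n)%N) (n_lt_m : (n < m)%N)
    (A : 'M[R]_(m, n)) (rankA : \rank A = n)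
    (F : 'M[R]_(p, m)) (FA0 : F *m A = 0)
    (S : nat) (S_ge1 : (1 <= S)%N) (S_le : (3 * S <= m)%N)
    (hF : ric F S + roc F S S + roc F S (2 * S)%N < 1)
    (f : 'cV[R]_n) (e : 'cV[R]_m)
    (T : {set 'I_m}) (T_le : (#|T| <= S)%N) (eT : supported_on e T)
    (y : 'cV[R]_m) (y_def : y = A *m f + e) :
  unique (minimizer (fun g : 'cV[R]_n => norm1 (y - A *m g))) f.
Proof.
have strict g : norm1 (y - A *m g) <= norm1 (y - A *m f) -> f = g.
  pose h := A *m (g - f).
  have -> : y - A *m g = e - h.
    by rewrite y_def /h mulmxBr opprB addrAC addrC addrCA addrA.
  have -> : y - A *m f = e by rewrite y_def addrC addKr.
  move=> le_e.
  have h0 : h = 0.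
    apply: (null_space_property S_ge1 S_le hF _ T_le).
      by rewrite mulmxA FA0 mul0mx.
    by have := l1_decrease_le_increase h eT; lra.
  have fullA : row_full A by rewrite /row_full rankA.
  apply: (row_full_inj fullA); apply/esym/eqP.
  by rewrite -subr_eq0 -mulmxBr -/h h0.
split=> [g|g /(_ f)]; last exact: strict.
by rewrite leNgt; apply/negP => /[dup] /ltW/strict <-; rewrite ltxx.
Qed.
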